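(* Let $n \geqslant 1$ be an integer and let $T$ be a triangulation of an arbitrary closed $n$-manifold. If $T$ is facet 2-colorable, then $T$ is Grünbaum hyper-colorable.
   Context: An $n$-manifold means a compact $n$-dimensional manifold without boundary (a closed manifold). A triangulation $T$ of an $n$-manifold $M$ is a (finite) simplicial $n$-complex whose carrier $|T|$ is homeomorphic to $M$. The $n$-simplexes of $T$ are called facets; each facet has exactly $n+1$ faces of dimension $n-1$. $T$ is facet 2-colorable if the facets of $T$ can be colored with two colors (black and white) so that any two distinct facets that have a common $(n-1)$-face are colored differently. $T$ is Grünbaum hyper-colorable if the $(n-1)$-simplexes of $T$ can be colored with $n+1$ colors so that for each facet of $T$ all $n+1$ colors occur among its $(n-1)$-faces (equivalently, the $n+1$ faces of dimension $n-1$ of each facet receive pairwise different colors). *)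

(* Defs.v *)
From mathcomp Require Import all_boot all_order all_algebra finmap.
From mathcomp Require Import all_classical all_reals all_analysis.

Set Implicit Arguments.
Unset Strict Implicit.
Unset Printing Implicit Defensive.

Import Order.TTheory GRing.Theory Num.Theory.
Import numFieldNormedType.Exports.

Local Open Scope classical_set_scope.
Local Open Scope ring_scope.

(* A and B carry their subspace topologies; f and g are mutually inverse
   between A and B, and their values elsewhere are irrelevant. *)
Definition homeomorphic (X Y : topologicalType) (A : set X) (B : set Y) : Prop :=
  exists (f : X -> Y) (g : Y -> X),
    [/\ {within A, continuous f}, {within B, continuous g},
        set_fun A B f, set_fun B A g
      & (forall x, A x -> g (f x) = x) /\ (forall y, B y -> f (g y) = y)].

Definition locally_euclidean (R : realType) (n : nat) (M : topologicalType)
    : Prop :=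
  forall x : M, exists U : set M,
    [/\ open U, U x & homeomorphic U [set: 'rV[R]_n]].

Definition closed_manifold (R : realType) (n : nat) (M : topologicalType)
    : Prop :=
  [/\ hausdorff_space M, @second_countable M, compact [set: M]
    & locally_euclidean R n M].

(* A simplex of R^N is encoded by its finite set of vertices; a k-simplex has
   k.+1 of them, and its faces are the nonempty subsets of its vertex set. *)
Section Complex.
Variables (R : realType) (N : nat).
Implicit Types (s t f : {fset 'rV[R]_N}) (T : {fset {fset 'rV[R]_N}}).

Definition affinely_independent s : Prop :=
  forall w : 'rV[R]_N -> R,
    \sum_(v <- s) w v = 0 -> \sum_(v <- s) w v *: v = 0 ->
    forall v, v \in s -> w v = 0.

Definition convex_hull s : set 'rV[R]_N :=
  [set x | exists w : 'rV[R]_N -> R,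
     [/\ forall v, v \in s -> 0 <= w v,
         \sum_(v <- s) w v = 1 & x = \sum_(v <- s) w v *: v]].

(* In the last clause u may be empty, in which case its hull is empty and the
   two simplexes are disjoint. *)
Definition simplicial_complex T : Prop :=
  [/\ forall s, s \in T -> s != fset0 /\ affinely_independent s,
      forall s t, s \in T -> (t `<=` s)%fset -> t != fset0 -> t \in T
    & forall s t, s \in T -> t \in T ->
        exists2 u : {fset 'rV[R]_N}, (u `<=` s)%fset && (u `<=` t)%fset
          & convex_hull s `&` convex_hull t = convex_hull u].

Definition simplex_of_dim T (k : nat) s : Prop :=
  s \in T /\ #|` s| = k.+1.

Definition simplicial_ncomplex (n : nat) T : Prop :=
  [/\ simplicial_complex T,
      forall s, s \in T -> (#|` s| <= n.+1)%N
    & exists s, simplex_of_dim T n s].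

Definition carrier T : set 'rV[R]_N :=
  [set x | exists2 s, s \in T & convex_hull s x].

Definition triangulation (n : nat) T (M : topologicalType) : Prop :=
  simplicial_ncomplex n T /\ homeomorphic (carrier T) [set: M].

Definition facet (n : nat) T s : Prop := simplex_of_dim T n s.

(* f is an (n-1)-dimensional face of s; used for 1 <= n only. *)
Definition ridge_of (n : nat) T f s : Prop :=
  simplex_of_dim T n.-1 f /\ (f `<=` s)%fset.

(* Colourings below are total functions on vertex sets; only their values on
   the facets, respectively on the (n-1)-simplexes, matter. *)
Definition facet_2colorable (n : nat) T : Prop :=
  exists c : {fset 'rV[R]_N} -> bool,
    forall s t, facet n T s -> facet n T t -> s <> t ->
      (exists f, ridge_of n T f s /\ ridge_of n T f t) -> c s <> c t.

Definition grunbaum_hyper_colorable (n : nat) T : Prop :=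
  exists c : {fset 'rV[R]_N} -> 'I_n.+1,
    forall s, facet n T s ->
      forall i : 'I_n.+1, exists2 f, ridge_of n T f s & c f = i.

End Complex.

(* Main.v *)
(* Three facets on a common (n-1)-simplex cannot have pairwise different colours
   out of two, so every (n-1)-simplex lies in at most one black and at most one
   white facet.  Hence the (n-1)-simplexes are the edges of a bipartite
   multigraph whose vertices are the facets (an (n-1)-simplex with no black,
   resp. white, facet gets a private endpoint), of maximal degree n+1, and
   Koenig's edge colouring theorem provides the required n+1 colours. *)
Require Import Defs.
From mathcomp Require Import all_boot all_order all_algebra finmap.
From mathcomp Require Import all_classical all_reals all_analysis.

Set Implicit Arguments.
Unset Strict Implicit.
Unset Printing Implicit Defensive.

(** Models one side of a bipartite multigraph: the entries of [s] are edges and [f] gives their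
    endpoints on that side. Two such maps describe the graph, and parallel edges are allowed. *)
Definition proper_at (E V C : eqType) (s : seq E) (f : E -> V) (c : E -> C) :=
  {in s &, forall e e', f e = f e' -> c e = c e' -> e = e'}.

Lemma missing_color (E V : eqType) k (s : seq E) (f : E -> V)
    (c : E -> 'I_k.+1) v :
  (count (fun e => f e == v) s <= k)%N ->
  exists a, {in s, forall e, f e = v -> c e <> a}.
Proof.
move=> le_k; apply: contrapT => no_a.
have sub : {subset enum 'I_k.+1 <= [seq c e | e <- s & f e == v]}.
  move=> a _; apply: contrapT => a_notin; apply: no_a; exists a => e es fe ce.
  by apply: a_notin; apply/mapP; exists e => //; rewrite mem_filter fe eqxx.
have := uniq_leq_size (enum_uniq _) sub.
by rewrite size_enum_ord size_map size_filter ltnNge le_k.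
Qed.

Section KempeChain.
Variables (E V W C : eqType) (s : seq E) (b : E -> V) (w : E -> W).
Variables (c : E -> C) (x : V) (y : W) (alpha beta : C).
Hypotheses (cb : proper_at s b c) (cw : proper_at s w c).
Hypothesis alphaNx : {in s, forall e, b e = x -> c e <> alpha}.
Hypothesis betaNy : {in s, forall e, w e = y -> c e <> beta}.

(* The chain is generated in one direction only, from the alpha-edge at y. *)
Inductive chain : E -> Prop :=
| chain_start e of e \in s & c e = alpha & w e = y : chain e
| chain_beta e e' of chain e & c e = alpha & e' \in s & c e' = beta
    & b e' = b e : chain e'
| chain_alpha e e' of chain e & c e = beta & e' \in s & c e' = alpha
    & w e' = w e : chain e'.

Lemma chain_in e : chain e -> e \in s. Proof. by case. Qed.

Lemma chain_color e : chain e -> c e = alpha \/ c e = beta.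
Proof. by case; auto. Qed.

Definition kempe e :=
  if `[< chain e >] then if c e == alpha then beta else alpha else c e.

Hypothesis neq_ab : alpha <> beta.

(** Beta-edges enter the chain only by [chain_beta], hence across a black endpoint. *)
Lemma chain_beta_inv e : chain e -> c e = beta ->
  exists e', [/\ chain e', c e' = alpha & b e' = b e].
Proof.
case=> [e1 _ -> //|e1 e2 ch1 c1 _ _ bE _|e1 e2 _ _ _ -> //].
by exists e1.
Qed.

Lemma chain_alpha_inv e : chain e -> c e = alpha ->
  w e = y \/ exists e', [/\ chain e', c e' = beta & w e' = w e].
Proof.
case=> [e1 _ _ -> _|e1 e2 _ _ _ -> _ /esym //|e1 e2 ch1 c1 _ _ wE _].
  by left.
by right; exists e1.
Qed.

(** From an alpha-edge, [chain_beta] reaches [e']. A beta-edge was itself entered from an alpha-edge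
    at the same black endpoint, which properness identifies with [e']. *)
Lemma chain_closed_b e e' : chain e -> e' \in s -> b e = b e' ->
  c e' = alpha \/ c e' = beta -> chain e'.
Proof.
move=> che e's bE ce'; have es := chain_in che.
have [ceE|neq] := eqVneq (c e) (c e'); first by rewrite -(cb es e's bE ceE).
case: (chain_color che) => ce; case: ce' => ce'; try by rewrite ce ce' eqxx in neq.
  exact: chain_beta che ce e's ce' (esym bE).
have [e1 [ch1 c1 b1]] := chain_beta_inv che ce.
suff <- : e1 = e' by [].
by apply: cb => //; [exact: chain_in | rewrite b1 | rewrite c1].
Qed.

Lemma chain_closed_w e e' : chain e -> e' \in s -> w e = w e' ->
  c e' = alpha \/ c e' = beta -> chain e'.
Proof.
move=> che e's wE ce'; have es := chain_in che.
have [ceE|neq] := eqVneq (c e) (c e'); first by rewrite -(cw es e's wE ceE).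
case: (chain_color che) => ce; case: ce' => ce'; try by rewrite ce ce' eqxx in neq.
  have [wy|[e1 [ch1 c1 w1]]] := chain_alpha_inv che ce.
    (* An alpha-edge that starts the chain ends at [y], where no beta-edge exists. *)
    by case: (betaNy e's _ ce'); rewrite -wE.
  suff <- : e1 = e' by [].
  by apply: cw => //; [exact: chain_in | rewrite w1 | rewrite c1].
exact: chain_alpha che ce e's ce' (esym wE).
Qed.

Lemma kempe_chain e : chain e -> kempe e = alpha \/ kempe e = beta.
Proof.
by move=> ch; rewrite /kempe asboolT //; case: eqP => _; [right | left].
Qed.

(** A clash between an edge of the chain and one outside it would be in alpha or beta, and [closed]
    would then put the outer edge in the chain. The map [f] is arbitrary so as to serve both
    sides. *)
Lemma kempe_proper (U : eqType) (f : E -> U) : proper_at s f c ->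
  (forall e e', chain e -> e' \in s -> f e = f e' ->
     c e' = alpha \/ c e' = beta -> chain e') ->
  proper_at s f kempe.
Proof.
move=> cf closed e e' es e's fE.
case: (pselect (chain e)) => ch; case: (pselect (chain e')) => ch'.
- move=> kE; apply: cf => //; move: kE; rewrite /kempe !asboolT //.
  by case: (chain_color ch) => ->; case: (chain_color ch') => ->;
     rewrite ?eqxx //; case: eqP => // ? /esym.
- move=> kE; have := kempe_chain ch; rewrite kE /kempe asboolF //.
  by move/(closed _ _ ch e's fE).
- move=> kE; have := kempe_chain ch'; rewrite -kE /kempe asboolF //.
  by move/(closed _ _ ch' es (esym fE)).
- by rewrite /kempe !asboolF //; exact: cf.
Qed.

(* A beta-edge of the chain has an alpha-edge at its black endpoint, so the
   chain does not reach x. *)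
Lemma kempe_missing_b : {in s, forall e, b e = x -> kempe e <> alpha}.
Proof.
move=> e es bx; rewrite /kempe; case: asboolP => ch; last exact: alphaNx.
case: eqP => [_ /esym //|nca].
case: (chain_color ch) => // cbeta.
have [e1 [ch1 c1 b1]] := chain_beta_inv ch cbeta.
by case: (alphaNx (chain_in ch1) _ c1); rewrite b1.
Qed.

(** Every alpha-edge at [y] starts the chain and turns beta, and there is no beta-edge at [y] to
    turn alpha. *)
Lemma kempe_missing_w : {in s, forall e, w e = y -> kempe e <> alpha}.
Proof.
move=> e es wy; rewrite /kempe; case: asboolP => [ch|nch].
  case: eqP => [_ /esym //|nca].
  by case: (chain_color ch) => // /(betaNy es wy).
by move=> ca; apply: nch; apply: chain_start.
Qed.

End KempeChain.

Lemma proper_at_cons (E V C : eqType) (s : seq E) (f : E -> V) (c : E -> C)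
    e0 a :
  e0 \notin s -> proper_at s f c ->
  {in s, forall e, f e = f e0 -> c e <> a} ->
  proper_at (e0 :: s) f (fun e => if e == e0 then a else c e).
Proof.
move=> e0s cf miss e e'; rewrite !inE.
have [->|ne] := eqVneq e e0; have [->|ne'] := eqVneq e' e0 => //=.
- by move=> _ es fE /esym ca; case: (miss _ es (esym fE)).
- by move=> es _ fE ca; case: (miss _ es fE).
- exact: cf.
Qed.

Theorem bipartite_edge_coloring (E V W : eqType) k (s : seq E)
    (b : E -> V) (w : E -> W) :
  uniq s ->
  (forall v, count (fun e => b e == v) s <= k.+1)%N ->
  (forall v, count (fun e => w e == v) s <= k.+1)%N ->
  exists c : E -> 'I_k.+1, proper_at s b c /\ proper_at s w c.
Proof.
elim: s => [|e0 s IH] /=; first by exists (fun=> ord0).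
move=> /andP[e0s us] degb degw.
have [||c [cb cw]] := IH us.
- by move=> v; apply: leq_trans (degb v); rewrite leq_addl.
- by move=> v; apply: leq_trans (degw v); rewrite leq_addl.
have [alpha alphaNx] : exists a, {in s, forall e, b e = b e0 -> c e <> a}.
  (* [e0] counts towards the degree, so at most [k] edges of [s] share its endpoint, against [k.+1]
     colours. *)
  by apply: missing_color; have := degb (b e0); rewrite eqxx.
have [beta betaNy] : exists a, {in s, forall e, w e = w e0 -> c e <> a}.
  by apply: missing_color; have := degw (w e0); rewrite eqxx.
have [eq_ab|/eqP neq_ab] := eqVneq alpha beta.
  exists (fun e => if e == e0 then alpha else c e).
  by split; apply: proper_at_cons => //; rewrite eq_ab.
(* Swapping along the chain from the white end of [e0] frees alpha there and keeps it free at the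
   black end. *)
exists (fun e => if e == e0 then alpha else kempe s b w c (w e0) alpha beta e).
split; apply: proper_at_cons => //.
- by apply: kempe_proper => // e e'; apply: chain_closed_b.
- exact: kempe_missing_b.
- by apply: kempe_proper => // e e'; apply: chain_closed_w.
- exact: kempe_missing_w.
Qed.

Section Facets.
Local Open Scope fset_scope.
Variables (K : choiceType) (n : nat).
Implicit Types (e s t v : {fset K}).

Lemma fset_card_predE e v : e `<=` v -> #|` e| = n -> #|` v| = n.+1 ->
  exists2 x, x \in v & e = v `\ x.
Proof.
move=> ev ce cv.
have /cardfs1P[x xE] : #|` v `\` e| == 1%N.
  by rewrite cardfsD (fsetIidPr ev) ce cv subSnn.
exists x; first by have := fset11 x; rewrite -xE inE => /andP[].
by rewrite -xE fsetDDr fsetDv fset0U (fsetIidPr ev).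
Qed.

(** This bounds the degree of an endpoint [v]: at a facet, each edge omits one of its [n.+1]
    vertices; a private endpoint meets only the edge equal to it. *)
Lemma count_faces (r : seq {fset K}) v : uniq r ->
  {in r, forall e, [/\ #|` e| = n, e `<=` v & #|` v| = n.+1 \/ v = e]} ->
  (size r <= n.+1)%N.
Proof.
move=> ur rP; case: (eqVneq #|` v| n.+1) => cv.
  rewrite -cv -(size_map (fun x => v `\ x)); apply: uniq_leq_size => // e er.
  have [ce ev _] := rP _ er; have [x xv ->] := fset_card_predE ev ce cv.
  by apply/mapP; exists x.
apply: (@leq_trans 1%N) => //.
apply: (@uniq_leq_size _ _ [:: v]) => // e er; rewrite inE.
by have [_ _ [/eqP|->//]] := rP _ er; rewrite (negPf cv).
Qed.

Variables (T : {fset {fset K}}) (col : {fset K} -> bool).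
Hypothesis colP : forall s t e, s \in T -> t \in T ->
  #|` s| = n.+1 -> #|` t| = n.+1 -> #|` e| = n -> e `<=` s -> e `<=` t ->
  col s = col t -> s = t.

(* The default value e serves as a private endpoint: it is not a facet. *)
Definition cofacet d e : {fset K} :=
  head e [seq t <- T | [&& #|` t| == n.+1, col t == d & e `<=` t]].

Lemma cofacet_spec d e :
  e `<=` cofacet d e /\ (#|` cofacet d e| = n.+1 \/ cofacet d e = e).
Proof.
rewrite /cofacet; case E: [seq _ <- _ | _] => [|t r] /=; first by split; auto.
by have := mem_head (t : {fset K}) r; rewrite -E mem_filter => /andP[/and3P[/eqP ? _ ?] _]; auto.
Qed.

(** By [colP] the filtered list has no entry other than [s], so taking its head involves no
    choice. *)
Lemma cofacetE e s : s \in T -> #|` s| = n.+1 -> #|` e| = n -> e `<=` s ->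
  cofacet (col s) e = s.
Proof.
move=> sT cs ce es; rewrite /cofacet; case E: [seq _ <- _ | _] => [|t r] /=.
  have : s \in [::] by rewrite -E mem_filter cs !eqxx es.
  by [].
have := mem_head (t : {fset K}) r; rewrite -E mem_filter => /andP[/and3P[/eqP ct /eqP colt et] tT].
exact: colP ct cs ce et es colt.
Qed.

Lemma facet_2coloring_hyper_coloring :
  (forall s x, s \in T -> #|` s| = n.+1 -> x \in s -> s `\ x \in T) ->
  exists c : {fset K} -> 'I_n.+1, forall s, s \in T -> #|` s| = n.+1 ->
    forall i, exists2 x, x \in s & c (s `\ x) = i.
Proof.
move=> faceT; pose r : seq {fset K} := [seq e <- T | #|` e| == n].
have ur : uniq r by rewrite filter_uniq ?fset_uniq.
have deg d v : (count (fun e => cofacet d e == v) r <= n.+1)%N.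
  rewrite -size_filter; apply: (@count_faces _ v); first by rewrite filter_uniq.
  move=> e; rewrite !mem_filter => /and3P[/eqP <- /eqP ce _].
  by have [] := cofacet_spec d e.
have [c [cb cw]] := bipartite_edge_coloring ur (deg true) (deg false).
have cP d : proper_at r (cofacet d) c by case: d.
exists c => s sT cs i.
have card_face x : x \in s -> #|` s `\ x| = n.
  by move=> xs; move: cs; rewrite (cardfsD1 x) xs add1n => -[].
have face_r x : x \in s -> s `\ x \in r.
  by move=> xs; rewrite mem_filter card_face // eqxx faceT.
(* All faces of [s] meet at the endpoint [s] on the side of its colour, so properness separates
   them. *)
have cinj : {in s &, injective (fun x => c (s `\ x))}.
  move=> x y xs ys /= cE.
  have /fsetP/(_ x) : s `\ x = s `\ y.
    apply: (cP (col s)) => //; try exact: face_r.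
    by rewrite !cofacetE ?card_face // fsubD1set.
  by rewrite !inE eqxx xs andbT; case: eqP.
have cuniq : uniq [seq c (s `\ x) | x <- s] by rewrite map_inj_in_uniq.
(* Pigeonhole: [n.+1] distinct values among [n.+1] colours exhaust them. *)
have /(uniq_min_size cuniq)[|_ /(_ i)] :
    {subset [seq c (s `\ x) | x <- s] <= enum 'I_n.+1}.
  by move=> j _; rewrite mem_enum.
  by rewrite size_enum_ord size_map cs.
by rewrite mem_enum => /mapP[x xs ->]; exists x.
Qed.

End Facets.

Theorem theorem1 (R : realType) (n : nat) (hn : (1 <= n)%N)
    (M : topologicalType) (hM : closed_manifold R n M)
    (N : nat) (T : {fset {fset 'rV[R]_N}}) (hT : triangulation n T M) :
  facet_2colorable n T -> grunbaum_hyper_colorable n T.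
Proof.
case=> col colP; have [[[_ subT _] _ _] _] := hT.
have nE : n.-1.+1 = n by rewrite prednK.
have faceT s x : s \in T -> #|` s| = n.+1 -> x \in s -> (s `\ x)%fset \in T.
  move=> sT cs xs; apply: (subT s) => //; first exact: fsubD1set.
  (* The face keeps [n] vertices, so [hn] makes it nonempty. *)
  by rewrite -cardfs_gt0; move: cs; rewrite (cardfsD1 x) xs add1n => -[->].
have [||c cP] := @facet_2coloring_hyper_coloring _ n T col.
- move=> s t e sT tT cs ct ce es et colE; apply: contrapT => /colP neq.
  apply: neq colE => //; exists e.
  have eT : e \in T by apply: (subT s) => //; rewrite -cardfs_gt0 ce.
  by split; split => //; split => //; rewrite nE.
- exact: faceT.
exists c => s [sT cs] i; have [x xs cx] := cP s sT cs i.
exists (s `\ x)%fset => //; split; last exact: fsubD1set.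
split; first exact: faceT.
by rewrite nE; move: cs; rewrite (cardfsD1 x) xs add1n => -[].
Qed.
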